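(* The group $\tilde G=\langle a,\tilde b,\tilde c,\tilde d\rangle$ is spherically transitive, fractal, and regular branch over its subgroup $\tilde K=\langle u,v\rangle^{\tilde G}$ (the normal closure of $\{u,v\}$ in $\tilde G$), where $u=(a\tilde b)^2$ and $v=(a\tilde d)^2$.
   Context: Let $\mathcal T_2=\{0,1\}^*$ be the binary rooted tree, $\Sigma=\{0,1\}$; automorphisms act on the left on finite words. For a letter $x$ let $\overline x=x+1\bmod 2$. The automorphism $a$ is given by $a(x\sigma)=\overline x\sigma$. The automorphisms $\tilde b,\tilde c,\tilde d$ are defined recursively (all fixing both vertices of the first level) by $\tilde b(0x\sigma)=0\overline x\sigma$, $\tilde b(1\sigma)=1\tilde c(\sigma)$; $\tilde c(0\sigma)=0\sigma$, $\tilde c(1\sigma)=1\tilde d(\sigma)$; $\tilde d(0\sigma)=0\sigma$, $\tilde d(1\sigma)=1\tilde b(\sigma)$. $\tilde G$ is the subgroup of $\operatorname{Aut}(\mathcal T_2)$ generated by $a,\tilde b,\tilde c,\tilde d$. For $G<\operatorname{Aut}(\mathcal T_2)$: $\operatorname{Stab}_G(\sigma)$ is the stabilizer of the vertex $\sigma$, $\operatorname{Stab}_G(n)=\bigcap_{\sigma\in\Sigma^n}\operatorname{Stab}_G(\sigma)$. If $g$ fixes $\sigma$, $g_{|\sigma}$ is defined by $g(\sigma\tau)=\sigma\,g_{|\sigma}(\tau)$, and $\phi(h)=(h_{|0},h_{|1})$ for $h$ fixing the first level. $G$ is spherically transitive if it is transitive on $\Sigma^n$ for all $n$; fractal if $\operatorname{Stab}_G(\sigma)_{|\sigma}=G$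 for every vertex $\sigma$ (identifying the subtree at $\sigma$ with the whole tree); regular branch over $K$ if $K<\operatorname{Stab}_G(1)$ is a finite-index normal subgroup of $G$ with $K\times K<\phi(K)$. *)

(* Defs.v *)
From HB Require Import structures.
From mathcomp Require Import all_boot all_classical.

Set Implicit Arguments.
Unset Strict Implicit.
Unset Printing Implicit Defensive.

Local Open Scope classical_set_scope.
Local Open Scope group_scope.

(* The alphabet {0, 1} is [bool], with 0 = false, 1 = true and x + 1 = ~~ x.
   A vertex of the binary rooted tree is a word, read from the root. *)
Definition word := seq bool.

Definition child (v w : word) : Prop := exists x, w = rcons v x.

Definition adjacent (v w : word) : Prop := child v w \/ child w v.

Definition is_tree_aut (f : word -> word) : Prop :=
  [/\ bijective f, f [::] = [::] &
      forall v w, adjacent (f v) (f w) <-> adjacent v w].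

Record tree_aut := TreeAut {
  tree_fun :> word -> word;
  tree_autP : is_tree_aut tree_fun
}.

HB.instance Definition _ := gen_eqMixin tree_aut.
HB.instance Definition _ := gen_choiceMixin tree_aut.

Lemma tree_aut_ext (g h : tree_aut) : g =1 h -> g = h.
Proof.
case: g h => [f fP] [f' f'P] /= /funext E; case: f' / E f'P => f'P.
by rewrite (Prop_irrelevance fP f'P).
Qed.

Lemma tree_aut_bij (g : tree_aut) : bijective g.
Proof. by case: (tree_autP g). Qed.

Lemma tree_aut_inv_ex (g : tree_aut) : exists h, cancel g h /\ cancel h g.
Proof. by case: (tree_aut_bij g) => h; exists h. Qed.

Definition inv_fun (g : tree_aut) : word -> word :=
  projT1 (cid (tree_aut_inv_ex g)).

Lemma inv_funK (g : tree_aut) : cancel g (inv_fun g).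
Proof. by rewrite /inv_fun; case: cid => h []. Qed.

Lemma inv_funVK (g : tree_aut) : cancel (inv_fun g) g.
Proof. by rewrite /inv_fun; case: cid => h []. Qed.

Lemma is_tree_aut_id : is_tree_aut id.
Proof. by split=> //; exists id. Qed.

Lemma is_tree_aut_comp (g h : tree_aut) : is_tree_aut (g \o h).
Proof.
case: (tree_autP g) (tree_autP h) => bg g0 ag [bh h0 ah]; split => /=.
- exact: bij_comp.
- by rewrite h0.
- by move=> v w; rewrite ag.
Qed.

Lemma is_tree_aut_inv (g : tree_aut) : is_tree_aut (inv_fun g).
Proof.
case: (tree_autP g) => _ g0 ag; split.
- by exists g; [exact: inv_funVK | exact: inv_funK].
- by rewrite -{1}g0 inv_funK.
- by move=> v w; rewrite -ag !inv_funVK.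
Qed.

Definition tree_one : tree_aut := TreeAut is_tree_aut_id.
Definition tree_inv (g : tree_aut) : tree_aut := TreeAut (is_tree_aut_inv g).

(* Automorphisms act on the left: (g * h)(w) = g (h w). *)
Definition tree_mul (g h : tree_aut) : tree_aut :=
  TreeAut (is_tree_aut_comp g h).

Lemma tree_mulA : associative tree_mul.
Proof. by move=> g h k; apply: tree_aut_ext. Qed.

Lemma tree_mul1g : left_id tree_one tree_mul.
Proof. by move=> g; apply: tree_aut_ext. Qed.

Lemma tree_mulg1 : right_id tree_one tree_mul.
Proof. by move=> g; apply: tree_aut_ext. Qed.

Lemma tree_mulVg : left_inverse tree_one tree_inv tree_mul.
Proof. by move=> g; apply: tree_aut_ext => w /=; rewrite inv_funK. Qed.

Lemma tree_mulgV : right_inverse tree_one tree_inv tree_mul.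
Proof. by move=> g; apply: tree_aut_ext => w /=; rewrite inv_funVK. Qed.

HB.instance Definition _ := isGroup.Build tree_aut
  tree_mulA tree_mul1g tree_mulg1 tree_mulVg tree_mulgV.

Lemma tree_aut_root (g : tree_aut) : g [::] = [::].
Proof. by case: (tree_autP g). Qed.

Lemma tree_aut_child (g : tree_aut) (w : word) (x : bool) :
  exists y, g (rcons w x) = rcons (g w) y.
Proof.
have [_ _ ag] := tree_autP g.
have inj_g := bij_inj (tree_aut_bij g).
elim/last_ind: w x => [|w z IHw] x.
  have /ag : adjacent [::] (rcons [::] x) by left; exists x.
  case=> [[y ->]|[y]]; first by exists y.
  by rewrite tree_aut_root; case: (g _).
have /ag : adjacent (rcons w z) (rcons (rcons w z) x) by left; exists x.
case=> [[y ->]|[y]]; first by exists y.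
have [y' ->] := IHw z.
move=> /rcons_inj[/inj_g /(congr1 size)]; rewrite !size_rcons => E _.
by have := leqnSn (size w).+1; rewrite -E ltnn.
Qed.

Lemma size_tree_aut (g : tree_aut) (w : word) : size (g w) = size w.
Proof.
elim/last_ind: w => [|w x IHw]; first by rewrite tree_aut_root.
by have [y ->] := tree_aut_child g w x; rewrite !size_rcons IHw.
Qed.

(* The general section g(s t) = g(s) g_{|s}(t), of which the sections g_{|s}
   at fixed vertices s are a special case (see [section_fixE]). *)
Definition section_fun (g : tree_aut) (s : word) : word -> word :=
  fun t => drop (size s) (g (s ++ t)).

Lemma section_funE (g : tree_aut) (s t : word) :
  g (s ++ t) = g s ++ section_fun g s t.
Proof.
rewrite /section_fun.
have [p ->] : exists p, g (s ++ t) = g s ++ p.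
  elim/last_ind: t => [|t x [p Ep]]; first by exists [::]; rewrite !cats0.
  rewrite -rcons_cat; have [y ->] := tree_aut_child g (s ++ t) x.
  by exists (rcons p y); rewrite Ep rcons_cat.
by rewrite -(size_tree_aut g s) drop_size_cat.
Qed.

Lemma adjacent_cat (s v w : word) :
  adjacent (s ++ v) (s ++ w) <-> adjacent v w.
Proof.
have catI (p q : word) : s ++ p = s ++ q -> p = q.
  by move=> /eqP; rewrite eqseq_cat// eqxx => /eqP.
split; first by case=> -[x]; rewrite rcons_cat => /catI ->; [left|right]; exists x.
by case=> -[x ->]; [left|right]; exists x; rewrite rcons_cat.
Qed.

Lemma is_tree_aut_section (g : tree_aut) (s : word) :
  is_tree_aut (section_fun g s).
Proof.
split.
- exists (section_fun (tree_inv g) (g s)) => t.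
  + by rewrite {1}/section_fun -section_funE /= inv_funK size_tree_aut drop_size_cat.
  + have := section_funE (tree_inv g) (g s) t; rewrite /= inv_funK.
    rewrite {2}/section_fun => <-.
    by rewrite inv_funVK -(size_tree_aut g s) drop_size_cat.
- by rewrite /section_fun cats0 drop_oversize ?size_tree_aut.
- have [_ _ ag] := tree_autP g => v w.
  by rewrite -(adjacent_cat (g s)) -!section_funE ag adjacent_cat.
Qed.

Definition section (g : tree_aut) (s : word) : tree_aut :=
  TreeAut (is_tree_aut_section g s).

Lemma section_fixE (g : tree_aut) (s t : word) :
  g s = s -> g (s ++ t) = s ++ section g s t.
Proof. by move=> gs; rewrite section_funE gs. Qed.

Definition phi (g : tree_aut) : tree_aut * tree_aut :=
  (section g [:: false], section g [:: true]).

Definition subgroup (H : set tree_aut) : Prop :=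
  [/\ H 1, forall g h, H g -> H h -> H (g * h) & forall g, H g -> H g^-1].

Definition generated (A : set tree_aut) : set tree_aut :=
  smallest subgroup A.

Definition normal_closure (G A : set tree_aut) : set tree_aut :=
  generated [set x | exists k g, [/\ A k, G g & x = k ^ g]].

Definition stab (G : set tree_aut) (s : word) : set tree_aut :=
  [set g | G g /\ g s = s].

Definition stab_level (G : set tree_aut) (n : nat) : set tree_aut :=
  \bigcap_(s in [set s : word | size s = n]) stab G s.

Definition spherically_transitive (G : set tree_aut) : Prop :=
  forall (n : nat) (s t : word), size s = n -> size t = n ->
    exists2 g, G g & g s = t.

Definition fractal (G : set tree_aut) : Prop :=
  forall s : word, [set section g s | g in stab G s] = G.

Definition normal_subgroup (K G : set tree_aut) : Prop :=
  [/\ subgroup K, K `<=` G & forall k g, K k -> G g -> K (k ^ g)].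

(* Finitely many left cosets g K with g in G. *)
Definition finite_index (K G : set tree_aut) : Prop :=
  finite_set [set [set g * k | k in K] | g in G].

Definition regular_branch (G K : set tree_aut) : Prop :=
  [/\ K `<=` stab_level G 1, normal_subgroup K G, finite_index K G &
      K `*` K `<=` [set phi k | k in K]].

Definition a_fun (w : word) : word :=
  if w is x :: s then ~~ x :: s else [::].

Fixpoint b_fun (w : word) : word :=
  match w with
  | [:: false, x & s] => [:: false, ~~ x & s]
  | true :: s => true :: c_fun s
  | _ => w
  end
with c_fun (w : word) : word :=
  if w is true :: s then true :: d_fun s else w
with d_fun (w : word) : word :=
  if w is true :: s then true :: b_fun s else w.

Lemma is_tree_aut_invol (f : word -> word) :
  involutive f -> f [::] = [::] ->
  (forall w x, exists y, f (rcons w x) = rcons (f w) y) ->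
  is_tree_aut f.
Proof.
move=> fK f0 fC.
have fA v w : adjacent v w -> adjacent (f v) (f w).
  by case=> -[x ->]; [left; exact: fC|right; exact: fC].
split=> [||v w]; [by exists f | by [] |].
by split=> /fA //; rewrite !fK.
Qed.

Lemma is_tree_aut_a : is_tree_aut a_fun.
Proof.
apply: is_tree_aut_invol => //.
- by case=> [|x s] //=; rewrite negbK.
- by case=> [|z s] x /=; [exists (~~ x)|exists x].
Qed.

Lemma bcd_funK : [/\ involutive b_fun, involutive c_fun & involutive d_fun].
Proof.
suff H w : [/\ b_fun (b_fun w) = w, c_fun (c_fun w) = w & d_fun (d_fun w) = w].
  by split=> w; case: (H w).
elim: w => [|[] s [Eb Ec Ed]] //=; first by rewrite Eb Ec Ed.
by case: s {Eb Ec Ed} => [|x s] //=; rewrite negbK.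
Qed.

Lemma bcd_fun_rcons w x :
  [/\ exists y, b_fun (rcons w x) = rcons (b_fun w) y,
      exists y, c_fun (rcons w x) = rcons (c_fun w) y &
      exists y, d_fun (rcons w x) = rcons (d_fun w) y].
Proof.
elim: w => [|[] s [[y Eb] [z Ec] [t Ed]]] /=.
- by case: x; split; [exists true|exists true|exists true|
                      exists false|exists false|exists false].
- by rewrite Eb Ec Ed; split; [exists z|exists t|exists y].
- split; [|by exists x|by exists x].
  by case: s {Eb Ec Ed} => [|u s] /=; [exists (~~ x)|exists x].
Qed.

Lemma is_tree_aut_b : is_tree_aut b_fun.
Proof.
apply: is_tree_aut_invol => //; first by case: bcd_funK.
by move=> w x; case: (bcd_fun_rcons w x).
Qed.

Lemma is_tree_aut_c : is_tree_aut c_fun.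
Proof.
apply: is_tree_aut_invol => //; first by case: bcd_funK.
by move=> w x; case: (bcd_fun_rcons w x).
Qed.

Lemma is_tree_aut_d : is_tree_aut d_fun.
Proof.
apply: is_tree_aut_invol => //; first by case: bcd_funK.
by move=> w x; case: (bcd_fun_rcons w x).
Qed.

Definition aut_a : tree_aut := TreeAut is_tree_aut_a.
Definition aut_b : tree_aut := TreeAut is_tree_aut_b.
Definition aut_c : tree_aut := TreeAut is_tree_aut_c.
Definition aut_d : tree_aut := TreeAut is_tree_aut_d.

Definition Gtilde : set tree_aut :=
  generated [set aut_a; aut_b; aut_c; aut_d].

Definition elt_u : tree_aut := (aut_a * aut_b) ^+ 2.
Definition elt_v : tree_aut := (aut_a * aut_d) ^+ 2.

Definition Ktilde : set tree_aut := normal_closure Gtilde [set elt_u; elt_v].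

(* Main.v *)
Require Import Defs.
From mathcomp Require Import all_boot all_classical.

(** Every property is read off the sections of the generators at the two
    letters.  Writing an element fixing the first level as the pair of its
    sections, the generators satisfy
      b = (a, c),   c = (1, d),   d = (1, b),
    while a swaps the two subtrees; all four are involutions, and b, c, d
    commute.

    Self-similarity and fractality.  The sections of the generators are
    generators or trivial, so all sections of elements of the group stay in the
    group.  Conversely the elements b ^ a, d, b, c fix the letter 1 and have
    there the sections a, b, c, d; since taking the section at a fixed vertex is
    multiplicative, every element of the group is the section at 1 of an
    element fixing 1 ([letter_fractal]), and conjugating by a gives the same
    at the letter 0.  Induction on the vertex gives fractality, and the same
    induction gives transitivity, because a is transitive on the letters.

    Branching.  The elements u and v are the commutators [a, b] and [a, d], and
    u = (ca, ac).  Since d = (1, b) and c = (1, d), commutators with u kill the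
    coordinate at 0:
      [u, d] = (1, [ac, b]) = (1, u ^ c),   [u, c] = (1, [ac, d]) = (1, v ^ c).
    Both lie in the normal closure K.  Conjugating them by elements with
    arbitrary section at 1 yields (1, x ^ g) for all normal generators x ^ g of
    K, hence 1 x K inside phi(K); conjugation by a gives K x 1.

    Finite index.  Modulo K the element a commutes with b and d, the elements
    b, c, d commute with each other, and (ac) ^ 4 = 1, so that the quotient is
    an image of the product of the four-group generated by b and d with the
    dihedral group of order 8 generated by a and c ([coset_cover]). *)

Set Implicit Arguments.
Unset Strict Implicit.
Unset Printing Implicit Defensive.

Local Open Scope classical_set_scope.
Local Open Scope group_scope.

Local Notation a := aut_a.
Local Notation b := aut_b.
Local Notation c := aut_c.
Local Notation d := aut_d.

(** * Generated subgroups and normal closures *)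

Lemma subgroup_generated (A : set tree_aut) : subgroup (generated A).
Proof.
split=> [H [[]] //|g h Ag Ah H HA|g Ag H HA].
- by case: (HA) => -[_ HM _] _; apply: HM; [exact: Ag|exact: Ah].
- by case: (HA) => -[_ _ HV] _; apply: HV; exact: Ag.
Qed.

Lemma mem_generated (A : set tree_aut) g : A g -> generated A g.
Proof. by move=> Ag; apply: sub_gen_smallest. Qed.

Lemma generated_ind (A P : set tree_aut) :
  P 1 -> (forall g h, P g -> P h -> P (g * h)) -> (forall g, P g -> P g^-1) ->
  A `<=` P -> generated A `<=` P.
Proof. by move=> P1 PM PV; apply: smallest_sub. Qed.

Lemma normal_closure_normal (G A : set tree_aut) :
  subgroup G -> A `<=` G -> normal_subgroup (normal_closure G A) G.
Proof.
move=> [G1 GM GV] AG; have [K1 KM KV] := subgroup_generated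
  [set x | exists k g, [/\ A k, G g & x = k ^ g]].
split=> [//||].
  apply: generated_ind => // _ [k [g [Ak Gg ->]]].
  by apply/GM; [exact: GV|apply/GM; [exact: AG|]].
move=> k g Kk; move: k Kk g.
apply: (@generated_ind _ (fun k => forall g, G g ->
  normal_closure G A (k ^ g))).
- by move=> g _; rewrite conj1g.
- by move=> k l Kk Kl g Gg; rewrite conjMg; apply: KM; [exact: Kk|exact: Kl].
- by move=> k Kk g Gg; rewrite conjVg; apply: KV; exact: Kk.
move=> _ [k [g [Ak Gg ->]]] h Gh; apply: mem_generated.
by exists k, (g * h); split; [|exact: GM|rewrite conjgM].
Qed.

Lemma mem_normal_closure (G A : set tree_aut) k :
  subgroup G -> A k -> normal_closure G A k.
Proof.
by move=> [G1 _ _] Ak; apply: mem_generated; exists k, 1; rewrite conjg1.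
Qed.

(** * Sections *)

Lemma tree_mulE (g h : tree_aut) w : (g * h) w = g (h w). Proof. by []. Qed.

Lemma tree_mulVK (g : tree_aut) w : g^-1 (g w) = w.
Proof. by rewrite -tree_mulE mulVg. Qed.

Lemma tree_fixV (g : tree_aut) s : g s = s -> g^-1 s = s.
Proof. by move=> gs; rewrite -{1}gs tree_mulVK. Qed.

Lemma tree_aut_letter (g : tree_aut) x : exists y, g [:: x] = [:: y].
Proof.
by have := size_tree_aut g [:: x]; case: (g _) => [|y []] // _; exists y.
Qed.

Lemma section1 s : section 1 s = 1.
Proof. by apply: tree_aut_ext => t /=; rewrite /section_fun drop_size_cat. Qed.

Lemma section_nil g : section g [::] = g.
Proof. by apply: tree_aut_ext => t /=; rewrite /section_fun drop0. Qed.

Lemma sectionM (g h : tree_aut) s :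
  section (g * h) s = section g (h s) * section h s.
Proof.
apply: tree_aut_ext => t /=; rewrite {1}/section_fun /= section_funE.
by rewrite -(size_tree_aut h s).
Qed.

Lemma sectionV (g : tree_aut) s :
  section g^-1 s = (section g (g^-1 s))^-1.
Proof.
by apply/esym/mulg1_eq; rewrite -sectionM mulgV section1.
Qed.

Lemma section_cat (g : tree_aut) s t :
  section g (s ++ t) = section (section g s) t.
Proof.
apply: tree_aut_ext => r; rewrite /= /section_fun /= /section_fun.
by rewrite drop_drop size_cat addnC catA.
Qed.

Lemma phi_sections (g x y : tree_aut) : phi g = (x, y) ->
  section g [:: false] = x /\ section g [:: true] = y.
Proof. by move=> gxy; rewrite -[x]/(x, y).1 -{2}[y]/(x, y).2 -gxy. Qed.

(** Taking the section at a fixed vertex is a morphism on its stabilizer. *)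
Lemma sectionM_fix (g h : tree_aut) s :
  h s = s -> section (g * h) s = section g s * section h s.
Proof. by rewrite sectionM => ->. Qed.

Lemma sectionV_fix (g : tree_aut) s :
  g s = s -> section g^-1 s = (section g s)^-1.
Proof. by move=> /tree_fixV gs; rewrite sectionV gs. Qed.

Lemma sectionJ_fix (g h : tree_aut) s : g s = s -> h s = s ->
  section (g ^ h) s = section g s ^ section h s.
Proof.
move=> gs hs; rewrite conjgE sectionM_fix ?tree_mulE ?hs //.
by rewrite sectionM_fix // sectionV_fix.
Qed.

Lemma sectionR_fix (g h : tree_aut) s : g s = s -> h s = s ->
  section [~ g, h] s = [~ section g s, section h s].
Proof.
move=> gs hs; rewrite commgEl sectionM_fix ?sectionV_fix ?sectionJ_fix //.
by rewrite conjgE !tree_mulE hs gs tree_fixV.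
Qed.

(** Fixing the first level is a normal property because conjugation permutes
    the letters. *)
Lemma fix_letterJ (g h : tree_aut) :
  (forall x, g [:: x] = [:: x]) -> forall x, (g ^ h) [:: x] = [:: x].
Proof.
move=> gx x; rewrite conjgE !tree_mulE.
by have [y hy] := tree_aut_letter h x; rewrite hy gx -hy tree_mulVK.
Qed.

Lemma fix_letter (g : tree_aut) x y : g [:: x] = [:: x] -> g [:: y] = [:: y].
Proof.
move=> gx; have [-> //|] := eqVneq y x; have [z gy] := tree_aut_letter g y.
have [zx|] := eqVneq z x; last by case: x y z gy {gx} => [] [] [].
have := bij_inj (tree_aut_bij g); rewrite zx -gx in gy.
by move=> /(_ _ _ gy) [->]; rewrite eqxx.
Qed.

(** * The generators *)

Lemma section_a x : section a [:: x] = 1.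
Proof. by apply: tree_aut_ext => t /=; rewrite /section_fun /= drop0. Qed.

Lemma section_b0 : section b [:: false] = a.
Proof.
by apply: tree_aut_ext => -[|x t]; rewrite //= /section_fun /= drop0.
Qed.

Lemma section_b1 : section b [:: true] = c.
Proof. by apply: tree_aut_ext => t; rewrite /= /section_fun /= drop0. Qed.

Lemma section_c0 : section c [:: false] = 1.
Proof. by apply: tree_aut_ext => t; rewrite /= /section_fun /= drop0. Qed.

Lemma section_c1 : section c [:: true] = d.
Proof. by apply: tree_aut_ext => t; rewrite /= /section_fun /= drop0. Qed.

Lemma section_d0 : section d [:: false] = 1.
Proof. by apply: tree_aut_ext => t; rewrite /= /section_fun /= drop0. Qed.

Lemma section_d1 : section d [:: true] = b.
Proof. by apply: tree_aut_ext => t; rewrite /= /section_fun /= drop0. Qed.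

Definition section_gen := (section_a, section_b0, section_b1,
  section_c0, section_c1, section_d0, section_d1).

Lemma aK : a * a = 1.
Proof. by apply: tree_aut_ext => -[|x s] //=; rewrite negbK. Qed.

Lemma bK : b * b = 1.
Proof. by apply: tree_aut_ext => w /=; case: bcd_funK. Qed.

Lemma cK : c * c = 1.
Proof. by apply: tree_aut_ext => w /=; case: bcd_funK. Qed.

Lemma dK : d * d = 1.
Proof. by apply: tree_aut_ext => w /=; case: bcd_funK. Qed.

Lemma bcd_fun_comm w :
  [/\ b_fun (c_fun w) = c_fun (b_fun w), b_fun (d_fun w) = d_fun (b_fun w) &
      c_fun (d_fun w) = d_fun (c_fun w)].
Proof.
elim: w => [|[] s [bc bd cd]] /=; first by split.
  by rewrite bc bd cd.
by case: s {bc bd cd}.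
Qed.

Lemma commute_bc : commute b c.
Proof. by apply: tree_aut_ext => w; case: (bcd_fun_comm w). Qed.

Lemma commute_bd : commute b d.
Proof. by apply: tree_aut_ext => w; case: (bcd_fun_comm w). Qed.

Lemma commute_cd : commute c d.
Proof. by apply: tree_aut_ext => w; case: (bcd_fun_comm w). Qed.

(** The square of ac is the pair (d, d). *)
Lemma ac_exp4 : (a * c) ^+ 4 = 1.
Proof.
have [_ _ dd] := bcd_funK.
by apply: tree_aut_ext => -[|[] s] //=; rewrite dd.
Qed.

Lemma elt_uE : elt_u = [~ a, b].
Proof.
by rewrite /elt_u expg2 commgEl conjgE (mulg1_eq aK) (mulg1_eq bK) !mulgA.
Qed.

Lemma elt_vE : elt_v = [~ a, d].
Proof.
by rewrite /elt_v expg2 commgEl conjgE (mulg1_eq aK) (mulg1_eq dK) !mulgA.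
Qed.

(** * The group and its normal subgroup *)

Lemma Gtilde_group : subgroup Gtilde.
Proof. exact: subgroup_generated. Qed.

Lemma GtildeM g h : Gtilde g -> Gtilde h -> Gtilde (g * h).
Proof. by case: Gtilde_group => _ GM _; apply: GM. Qed.

Lemma GtildeV g : Gtilde g -> Gtilde g^-1.
Proof. by case: Gtilde_group => _ _; apply. Qed.

Lemma GtildeX g n : Gtilde g -> Gtilde (g ^+ n).
Proof.
move=> Gg; elim: n => [|n IHn]; first by case: Gtilde_group.
by rewrite expgS; apply: GtildeM.
Qed.

Lemma Gtilde_a : Gtilde a.
Proof. by apply: mem_generated; left; left; left. Qed.

Lemma Gtilde_b : Gtilde b.
Proof. by apply: mem_generated; left; left; right. Qed.

Lemma Gtilde_c : Gtilde c.
Proof. by apply: mem_generated; left; right. Qed.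

Lemma Gtilde_d : Gtilde d.
Proof. by apply: mem_generated; right. Qed.

Lemma Gtilde_ind (P : set tree_aut) :
  P 1 -> (forall g h, P g -> P h -> P (g * h)) -> (forall g, P g -> P g^-1) ->
  [/\ P a, P b, P c & P d] -> Gtilde `<=` P.
Proof.
move=> P1 PM PV [Pa Pb Pc Pd]; apply: generated_ind => // g.
by case=> [[[->|->]|->]|->].
Qed.

Lemma Ktilde_normal : normal_subgroup Ktilde Gtilde.
Proof.
apply: normal_closure_normal; first exact: Gtilde_group.
have [Ga Gb Gd] := And3 Gtilde_a Gtilde_b Gtilde_d.
by move=> g [->|->]; apply: GtildeX; apply: GtildeM.
Qed.

Lemma KtildeM g h : Ktilde g -> Ktilde h -> Ktilde (g * h).
Proof. by case: Ktilde_normal => -[_ KM _] _ _; apply: KM. Qed.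

Lemma KtildeV g : Ktilde g -> Ktilde g^-1.
Proof. by case: Ktilde_normal => -[_ _ KV] _ _; apply: KV. Qed.

Lemma Ktilde_sub : Ktilde `<=` Gtilde.
Proof. by case: Ktilde_normal. Qed.

Lemma KtildeJ k g : Ktilde k -> Gtilde g -> Ktilde (k ^ g).
Proof. by case: Ktilde_normal => _ _; apply. Qed.

Lemma KtildeR k g : Ktilde k -> Gtilde g -> Ktilde [~ k, g].
Proof. by move=> Kk Gg; apply: KtildeM; [exact: KtildeV|exact: KtildeJ]. Qed.

Lemma Ktilde_u : Ktilde elt_u.
Proof. by apply: mem_normal_closure; [exact: Gtilde_group|left]. Qed.

Lemma Ktilde_v : Ktilde elt_v.
Proof. by apply: mem_normal_closure; [exact: Gtilde_group|right]. Qed.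

Lemma elt_u_fix x : elt_u [:: x] = [:: x].
Proof. by case: x. Qed.

Lemma elt_v_fix x : elt_v [:: x] = [:: x].
Proof. by case: x. Qed.

Lemma Ktilde_fix k x : Ktilde k -> k [:: x] = [:: x].
Proof.
move=> Kk; move: k Kk x; apply: generated_ind.
- by [].
- by move=> g h gx hx x; rewrite tree_mulE hx gx.
- by move=> g gx x; apply: tree_fixV.
by move=> _ [k [g [[->|->] _ ->]]] x; apply: fix_letterJ;
  [exact: elt_u_fix|exact: elt_v_fix].
Qed.

(** * Self-similarity, fractality and transitivity *)

Lemma Gtilde_section_letter g x : Gtilde g -> Gtilde (section g [:: x]).
Proof.
move=> Gg; move: g Gg x; have [G1 _ _] := Gtilde_group; apply: Gtilde_ind.
- by move=> x; rewrite section1.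
- move=> g h Sg Sh x; rewrite sectionM; have [y ->] := tree_aut_letter h x.
  by apply: GtildeM.
- move=> g Sg x; rewrite sectionV; have [y ->] := tree_aut_letter g^-1 x.
  by apply: GtildeV.
have [Ga Gb Gc Gd] := And4 Gtilde_a Gtilde_b Gtilde_c Gtilde_d.
by split=> [] [] /=; rewrite section_gen.
Qed.

Lemma Gtilde_section g s : Gtilde g -> Gtilde (section g s).
Proof.
elim: s g => [|x s IHs] g Gg; first by rewrite section_nil.
by rewrite -cat1s section_cat; apply: IHs; exact: Gtilde_section_letter.
Qed.

Lemma letter_fractal x g : Gtilde g ->
  exists h, [/\ Gtilde h, h [:: x] = [:: x] & section h [:: x] = g].
Proof.
move: g; have [Ga Gb Gc Gd] := And4 Gtilde_a Gtilde_b Gtilde_c Gtilde_d.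
have at1 : Gtilde `<=` [set g | exists h,
    [/\ Gtilde h, h [:: true] = [:: true] & section h [:: true] = g]].
  apply: Gtilde_ind => [|_ _ [g [Gg g1 <-]] [h [Gh h1 <-]]|_ [g [Gg g1 <-]]|].
  - by exists 1; rewrite section1; split=> //; case: Gtilde_group.
  - exists (g * h); split; [exact: GtildeM|by rewrite tree_mulE h1|].
    by rewrite sectionM_fix.
  - exists g^-1; split; [exact: GtildeV|exact: tree_fixV|].
    by rewrite sectionV_fix.
  split; [|by exists d; rewrite section_gen|by exists b; rewrite section_gen|
           by exists c; rewrite section_gen].
  exists (a * b * a); split=> //; first by do !apply: GtildeM.
  by rewrite !sectionM /= !section_gen mul1g mulg1.
move=> _ /at1 [h [Gh h1 <-]]; case: x; first by exists h.
exists (a * h * a); split; first by do !apply: GtildeM.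
  by rewrite !tree_mulE /= h1.
by rewrite !sectionM /= !section_gen h1 section_a mul1g mulg1.
Qed.

Lemma Gtilde_fractal : fractal Gtilde.
Proof.
move=> s; apply/seteqP; split=> [_ [g [Gg _] <-]|]; first exact: Gtilde_section.
elim: s => [|x s IHs] g Gg.
  by exists g; [split=> //; exact: tree_aut_root|exact: section_nil].
have [h [Gh hs] <-] := IHs g Gg; have [k [Gk kx kh]] := letter_fractal x Gh.
exists k; last by rewrite -cat1s section_cat kh.
by split=> //; rewrite -cat1s section_fixE // kh hs.
Qed.

Lemma Gtilde_transitive : spherically_transitive Gtilde.
Proof.
elim=> [|n IHn] [|x s] [|y t] //=; first by exists 1 => //; case: Gtilde_group.
move=> [/IHn IHs] [/IHs [g Gg gs]].
have [h [Gh hx hg]] := letter_fractal x Gg.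
have hst : h (x :: s) = x :: t by rewrite -cat1s section_fixE // hg gs.
have [<-|xy] := eqVneq x y; first by exists h.
exists (a * h); first by apply: GtildeM; [exact: Gtilde_a|].
by rewrite tree_mulE hst /=; case: x y xy {hx hst hg} => [] [].
Qed.

(** * Branching *)

Lemma section_u0 : section elt_u [:: false] = c * a.
Proof. by rewrite /elt_u expg2 !sectionM /= !section_gen !mul1g. Qed.

Lemma section_u1 : section elt_u [:: true] = a * c.
Proof. by rewrite /elt_u expg2 !sectionM /= !section_gen !mul1g. Qed.

Lemma commg_mul_commute (x y z : tree_aut) :
  commute y z -> [~ x * y, z] = [~ x, z] ^ y.
Proof.
move=> yz; have {}yz : y ^ z = y by rewrite conjgE yz mulKg.
rewrite !commgEl conjMg yz invgM.
by rewrite (conjgE _ y) !mulgA.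
Qed.

(** Since d = (1, b) and c = (1, d), only the section ac of u at 1 survives in
    the commutators; c factors out of [ac, _] as it commutes with b and d. *)
Lemma phi_commg_ud : phi [~ elt_u, d] = (1, elt_u ^ c).
Proof.
rewrite /phi !sectionR_fix ?elt_u_fix // section_u0 section_u1 !section_gen.
by rewrite commg1 commg_mul_commute ?elt_uE //; exact: commute_sym commute_bc.
Qed.

Lemma phi_commg_uc : phi [~ elt_u, c] = (1, elt_v ^ c).
Proof.
rewrite /phi !sectionR_fix ?elt_u_fix // section_u0 section_u1 !section_gen.
by rewrite commg1 commg_mul_commute ?elt_vE //; exact: commute_cd.
Qed.

(** Conjugating by an element with section g at 1 keeps the coordinate at 0
    trivial and conjugates the other one by g. *)
Lemma branch_conj k x g : Ktilde k -> phi k = (1, x) -> Gtilde g ->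
  exists2 l, Ktilde l & phi l = (1, x ^ g).
Proof.
move=> Kk /phi_sections[k0 k1] Gg.
have [h [Gh h1 hg]] := letter_fractal true Gg.
exists (k ^ h); first exact: KtildeJ.
have h0 : h [:: false] = [:: false] by apply: fix_letter h1.
by rewrite /phi !sectionJ_fix ?(Ktilde_fix _ Kk) // k0 k1 hg conj1g.
Qed.

Lemma branch1 k : Ktilde k -> exists2 l, Ktilde l & phi l = (1, k).
Proof.
have Gc := Gtilde_c; move: k; apply: generated_ind => [|g h|g|].
- by exists 1; [case: Ktilde_normal => -[]|rewrite /phi !section1].
- move=> [k Kk /phi_sections[k0 k1]] [l Kl /phi_sections[l0 l1]].
  exists (k * l); first exact: KtildeM.
  by rewrite /phi !sectionM_fix ?(Ktilde_fix _ Kl) // k0 k1 l0 l1 mulg1.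
- move=> [k Kk /phi_sections[k0 k1]]; exists k^-1; first exact: KtildeV.
  by rewrite /phi !sectionV_fix ?(Ktilde_fix _ Kk) // k0 k1 invg1.
move=> _ [x [g [ux Gg ->]]].
(* The available elements are (1, x ^ c), and c is an involution. *)
have -> : x ^ g = (x ^ c) ^ (c * g) by rewrite -conjgM mulgA cK mul1g.
have Gcg : Gtilde (c * g) by apply: GtildeM.
case: ux => ->.
- by apply: branch_conj phi_commg_ud Gcg; apply: KtildeR Ktilde_u Gtilde_d.
- by apply: branch_conj phi_commg_uc Gcg; apply: KtildeR Ktilde_u Gtilde_c.
Qed.

Lemma branch : Ktilde `*` Ktilde `<=` [set phi k | k in Ktilde].
Proof.
move=> [k0 k1] /= [/branch1 [l Kl ll] /branch1 [m Km mm]].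
have [l0 l1] := phi_sections ll; have [m0 m1] := phi_sections mm.
have la x : section (l ^ a) [:: x] = section l [:: ~~ x].
  rewrite conjgE (mulg1_eq aK) !sectionM /= (Ktilde_fix _ Kl) !section_a.
  by rewrite mul1g mulg1.
have Kla := KtildeJ Kl Gtilde_a; exists (l ^ a * m); first exact: KtildeM.
rewrite /phi ![section (_ * m) _]sectionM_fix ?(Ktilde_fix _ Km) //.
by rewrite !la /= l0 l1 m0 m1 mul1g mulg1.
Qed.

(** * Finite index *)

(** Coset representatives; the exponent n only matters modulo 4. *)
Definition coset_rep (i j : bool) (n : nat) (e : bool) : tree_aut :=
  b ^+ i * d ^+ j * ((a * c) ^+ n * c ^+ e).

Lemma mulg_expb_invol (x : tree_aut) (i : bool) :
  x * x = 1 -> x * x ^+ i = x ^+ (~~ i).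
Proof. by move=> xx; case: i; rewrite ?expg1 ?expg0 ?mulg1. Qed.

(** The commutators of a with b and d are the normal generators u and v. *)
Lemma a_commute_mod (i j : bool) : exists2 k, Ktilde k &
  a * (b ^+ i * d ^+ j) = b ^+ i * d ^+ j * a * k.
Proof.
have [Ku Kv Gd] := And3 Ktilde_u Ktilde_v Gtilde_d.
have ab : a * b = b * a * elt_u by rewrite elt_uE -commgC.
have ad : a * d = d * a * elt_v by rewrite elt_vE -commgC.
case: i j => [] [] /=; rewrite ?expg0 ?expg1 ?mul1g ?mulg1.
- have ud := conjgC elt_u d; have Kud := KtildeJ Ku Gd.
  move: elt_v (elt_u ^ d) Kv Kud ad ud => v w Kv Kw ad ud.
  exists (v * w); first exact: KtildeM.
  by rewrite mulgA ab -mulgA ud mulgA -(mulgA b) ad !mulgA.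
- by exists elt_u.
- by exists elt_v.
- by exists 1; rewrite ?mulg1 //; case: Ktilde_normal => -[].
Qed.

(** Conjugation by c inverts ac, and the inverse of ac is its cube. *)
Lemma c_mul_dihedral n (e : bool) :
  c * ((a * c) ^+ n * c ^+ e) = (a * c) ^+ (n * 3) * c ^+ (~~ e).
Proof.
rewrite mulgA -mulg_expb_invol; last exact: cK.
suff -> : c * (a * c) ^+ n = (a * c) ^+ (n * 3) * c by rewrite mulgA.
have cac : c * (a * c) = (a * c) ^+ 3 * c.
  have <- : (a * c)^-1 = (a * c) ^+ 3.
    by apply: mulg1_eq; rewrite -expgS ac_exp4.
  by rewrite invgM (mulg1_eq aK) (mulg1_eq cK) mulgA.
elim: n => [|n IHn]; first by rewrite !expg0 mulg1 mul1g.
by rewrite expgS mulgA cac -mulgA IHn mulSn expgnDr !mulgA.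
Qed.

(** The union of the cosets of the representatives contains 1 and is stable
    under left multiplication by the generators: b, c and d commute, so each of
    them reaches its own factor, and a = (ac)c is first moved past b and d at
    the price of an element of K. *)
Lemma coset_cover g : Gtilde g ->
  exists i j n e, exists2 k, Ktilde k & g = coset_rep i j n e * k.
Proof.
move: g; have [K1 Ga Gc] : [/\ Ktilde 1, Gtilde a & Gtilde c].
  by split; [case: Ktilde_normal => -[]|exact: Gtilde_a|exact: Gtilde_c].
pose T := [set g | exists i j n e, exists2 k,
  Ktilde k & g = coset_rep i j n e * k].
have T1 : T 1.
  by exists false, false, 0, false, 1; rewrite // /coset_rep !expg0 !mulg1.
(* The equivalence, unlike the implication, is stable under inverses of s. *)
suff GT : Gtilde `<=` [set s | forall t, T t <-> T (s * t)].
  by move=> g /GT /(_ 1); rewrite mulg1 => -[TT _]; exact: TT T1.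
have invol s : s * s = 1 -> (forall t, T t -> T (s * t)) ->
    forall t, T t <-> T (s * t).
  by move=> ss sT t; split=> [|/sT]; [exact: sT|rewrite mulgA ss mul1g].
have Tb t : T t -> T (b * t).
  move=> [i [j [n [e [k Kk ->]]]]]; exists (~~ i), j, n, e, k => //.
  by rewrite /coset_rep -(mulg_expb_invol _ bK) !mulgA.
have Td t : T t -> T (d * t).
  move=> [i [j [n [e [k Kk ->]]]]]; exists i, (~~ j), n, e, k => //.
  rewrite /coset_rep -(mulg_expb_invol _ dK) !mulgA.
  by have /commuteX -> := commute_sym commute_bd.
have Tc t : T t -> T (c * t).
  move=> [i [j [n [e [k Kk ->]]]]]; exists i, j, (n * 3)%N, (~~ e), k => //.
  rewrite /coset_rep -c_mul_dihedral !mulgA; do 3 congr (_ * _).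
  have cb := commuteX i (commute_sym commute_bc).
  by rewrite -mulgA; apply: commuteM => //; apply: commuteX commute_cd.
have Ta t : T t -> T (a * t).
  move=> [i [j [n [e [k Kk ->]]]]]; have [l Kl al] := a_commute_mod i j.
  set y := (a * c) ^+ n * c ^+ e.
  have Gy : Gtilde y by apply: GtildeM; apply: GtildeX => //; apply: GtildeM.
  exists i, j, (n * 3).+1, (~~ e), (l ^ y * k).
    by apply: KtildeM => //; apply: KtildeJ.
  rewrite /coset_rep expgS -(mulgA (a * c)) -c_mul_dihedral -/y.
  rewrite (mulgA (a * c)) -(mulgA a c c) cK mulg1.
  have ly := conjgC l y.
  move: (b ^+ i * d ^+ j) y (l ^ y) al ly {Gy} => r y w al ly.
  by rewrite 2!mulgA al -2!(mulgA (r * a)) ly !mulgA.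
apply: Gtilde_ind => [t|g h gT hT t|g gT t|].
- by rewrite mul1g.
- by rewrite -mulgA -gT.
- by rewrite (gT (g^-1 * t)) mulgA mulgV mul1g.
by split; apply: invol => //; [exact: aK|exact: bK|exact: cK|exact: dK].
Qed.

Lemma Ktilde_finite_index : finite_index Ktilde Gtilde.
Proof.
have [K1 KM KV] : subgroup Ktilde by case: Ktilde_normal.
pose f (p : bool * bool * 'I_4 * bool) : set tree_aut :=
  [set coset_rep p.1.1.1 p.1.1.2 p.1.2 p.2 * k | k in Ktilde].
have fin : finite_set (range f) by apply: finite_image; exact: finite_finset.
apply: sub_finite_set fin => _ [g Gg <-].
have [i [j [n [e [k Kk ->]]]]] := coset_cover Gg.
exists (i, j, Ordinal (ltn_pmod n (isT : 0 < 4)%N), e) => //; rewrite /f /=.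
have -> : coset_rep i j (n %% 4) e = coset_rep i j n e.
  rewrite /coset_rep {2}(divn_eq n 4) expgnDr mulnC expgnA ac_exp4 expg1n.
  by rewrite mul1g.
apply/seteqP; split=> _ [l Kl <-].
- exists (k^-1 * l); last by rewrite mulgA mulgK.
  by apply: KtildeM => //; apply: KtildeV.
- by exists (k * l); [exact: KtildeM|rewrite mulgA].
Qed.

Theorem proposition5p4 :
  [/\ spherically_transitive Gtilde,
      fractal Gtilde &
      regular_branch Gtilde Ktilde].
Proof.
split; [exact: Gtilde_transitive|exact: Gtilde_fractal|split].
- move=> k Kk s /= s1; split; first exact: Ktilde_sub.
  by case: s s1 => [|x []] // _; apply: Ktilde_fix.
- exact: Ktilde_normal.
- exact: Ktilde_finite_index.
- exact: branch.
Qed.
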